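(* Let $d=2\nu+1\ge3$ be odd, with indices of the standard basis $\{e_1,\dots,e_d\}$ of $\mathbf{C}^d$ taken mod $d$. For $m=1,\dots,d$ let $$V_m=\sum_{k=1}^{\nu}\big(|e_{m+k}\rangle\langle e_{m-k}|+|e_{m-k}\rangle\langle e_{m+k}|\big)=\Big(\sum_{j=1}^d|e_j\rangle\langle e_{2m-j}|\Big)-|e_m\rangle\langle e_m|,$$ and for $t\in(-1,1)$ let $A_m=V_m+t\,|e_m\rangle\langle e_m|\in M_d(\mathbf{C})$. Then $A_m=A_m^*$, the set $\{A_m^*A_n\}_{m,n=1}^d$ is linearly independent, and the map $\Phi(\rho)=\tfrac{1}{d-1+t^2}\sum_{k=1}^dA_k\rho A_k$ is an extreme point of both the set of CPT maps and the set of UCP maps on $M_d(\mathbf{C})$, (a) for all $t\in(-1,1)$ when $d=2\nu+1>3$, and (b) for all $t\in(-1,1)$ with $t\neq-\tfrac12$ when $d=3$.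
   Context: Linear maps $M_d(\mathbf{C})\to M_d(\mathbf{C})$ are called CPT if completely positive and trace-preserving, and UCP if completely positive and unital. Linear independence refers to the family of $d^2$ matrices indexed by pairs $(m,n)$. *)

(* Defs.v *)
From HB Require Import structures.
From mathcomp Require Import all_boot all_order all_algebra.
From mathcomp Require Import reals complex.

Set Implicit Arguments.
Unset Strict Implicit.
Unset Printing Implicit Defensive.

Import Order.TTheory GRing.Theory Num.Theory.
Local Open Scope ring_scope.
Local Open Scope complex_scope.
Local Open Scope sesquilinear_scope.

Section QuantumMaps.
Variables (R : realType) (d : nat).
Local Notation C := R[i].

(* In R[i], 0 <= z means that z is real and nonnegative; this condition
   therefore forces M to be self-adjoint. *)
Definition psdmx (n : nat) (M : 'M[C]_n) : Prop :=
  forall u : 'cV[C]_n, 0 <= (u ^t* *m M *m u) 0 0.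

(* id_n (x) Phi, under the identification of M_n(M_d(C)) with the n x n block
   matrices whose blocks are d x d. *)
Definition ampliation (n : nat) (Phi : 'End('M[C]_d))
    (X : 'M[C]_(\sum_(i < n) d)) : 'M[C]_(\sum_(i < n) d) :=
  \mxblock_(i < n, j < n)
    Phi (@submxblock _ n n (fun=> d) (fun=> d) X i j).

Definition completely_positive (Phi : 'End('M[C]_d)) : Prop :=
  forall (n : nat) (X : 'M[C]_(\sum_(i < n) d)),
    psdmx X -> psdmx (ampliation Phi X).

Definition trace_preserving (Phi : 'End('M[C]_d)) : Prop :=
  forall X : 'M[C]_d, \tr (Phi X) = \tr X.

Definition unital (Phi : 'End('M[C]_d)) : Prop := Phi 1%:M = 1%:M.

Definition CPT (Phi : 'End('M[C]_d)) : Prop :=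
  completely_positive Phi /\ trace_preserving Phi.

Definition UCP (Phi : 'End('M[C]_d)) : Prop :=
  completely_positive Phi /\ unital Phi.

Definition extreme_point (E : lmodType C) (S : E -> Prop) (x : E) : Prop :=
  S x /\
  forall (y z : E) (l : R), S y -> S z -> 0 < l < 1 ->
    x = l%:C *: y + (1 - l)%:C *: z -> y = x /\ z = x.

End QuantumMaps.

Section Family.
Variables (R : realType) (nu : nat).
Local Notation C := R[i].
Local Notation d := nu.*2.+1.

(* 'I_d carries the additive group structure of Z/d, so that m + inZp k and
   m - inZp k are the indices m + k and m - k taken mod d (e_d being e_0);
   delta_mx i j is |e_i><e_j|. *)
Definition V (m : 'I_d) : 'M[C]_d :=
  \sum_(1 <= k < nu.+1)
    (delta_mx (m + inZp k) (m - inZp k) + delta_mx (m - inZp k) (m + inZp k)).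

Definition A (t : R) (m : 'I_d) : 'M[C]_d := V m + t%:C *: delta_mx m m.

Definition conjugation_sum (t : R) (rho : 'M[C]_d) : 'M[C]_d :=
  ((d%:R - 1 + t ^+ 2)^-1)%:C *: \sum_(k < d) (A t k *m rho *m A t k).

Definition Phi (t : R) : 'End('M[C]_d) := linfun (conjugation_sum t).

Fact conjugation_sum_linear (t : R) : linear (conjugation_sum t).
Proof.
move=> a X Y; rewrite /conjugation_sum; set c := (_)%:C.
have -> : \sum_(k < d) (A t k *m (a *: X + Y) *m A t k) =
    a *: (\sum_(k < d) A t k *m X *m A t k) + \sum_(k < d) A t k *m Y *m A t k.
  rewrite scaler_sumr -big_split /=; apply: eq_bigr => k _.
  by move: (A t k) => B; rewrite mulmxDr mulmxDl -scalemxAr -scalemxAl.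
by rewrite scalerDr !scalerA mulrC.
Qed.

(* linfun is only meaningful on linear functions. *)
Fact PhiE (t : R) (rho : 'M[C]_d) : Phi t rho = conjugation_sum t rho.
Proof.
pose L := GRing.isLinear.Build _ _ _ _ _ (conjugation_sum_linear t).
pose f : {linear 'M[C]_d -> 'M[C]_d} := HB.pack (conjugation_sum t) L.
exact: (lfunE f rho).
Qed.

End Family.

(* Main.v *)
(* Freeness.  A_m A_n = R_m R_n up to rank-one corrections, where R_m is the
   reflection e_j |-> e_{2m-j}; it lives on the single diagonal
   i - j = 2(m - n), so a linear relation splits into one circulant system per
   c = m - n.  With s = 1 - t, the system for c = 0 has matrix J - (1 - t^2) 1
   (J being the all-ones matrix), and that for c <> 0 is J - s (1 + S^c) (S
   being the cyclic shift), which is singular only if 2 s = d, i.e. d = 3 and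
   t = -1/2.

   Extremality (Choi).  If Phi is a proper convex combination of Y and Z, the
   Choi matrix of Y is dominated by a multiple of that of Phi, so it factors
   through the Kraus operators K_k of Phi: writing L' for the adjoint of L,
   Y X = sum_{k,l} M_{kl} K_k X K_l'.  Trace preservation (resp. unitality) of Y
   and Phi and the freeness of the K_l' K_k (resp. K_k K_l') force M = 1. *)
Require Import Defs.
From mathcomp Require Import all_boot all_order all_algebra.
From mathcomp Require Import reals complex zify ring lra.

Set Implicit Arguments.
Unset Strict Implicit.
Unset Printing Implicit Defensive.

Import Order.TTheory GRing.Theory Num.Theory.
Local Open Scope ring_scope.
Local Open Scope complex_scope.
Local Open Scope sesquilinear_scope.

(** * Adjoints, and affine functions that stay nonnegative *)

Section Adjoint.
Variable C : numClosedFieldType.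

Lemma adjmxM (m n p : nat) (X : 'M[C]_(m, n)) (Y : 'M[C]_(n, p)) :
  (X *m Y)^t* = Y^t* *m X^t*.
Proof. by rewrite trmx_mul map_mxM. Qed.

Lemma adjmxZ (m n : nat) (a : C) (X : 'M[C]_(m, n)) :
  (a *: X)^t* = a^* *: X^t*.
Proof. by rewrite linearZ /= map_mxZ. Qed.

Lemma adjmxD (m n : nat) (X Y : 'M[C]_(m, n)) :
  (X + Y)^t* = X^t* + Y^t*.
Proof. by apply/matrixP => i j; rewrite !mxE rmorphD. Qed.

Lemma adj_mxcol (p n : nat) (p_ : 'I_p -> nat) (B : forall i, 'M[C]_(p_ i, n)) :
  (\mxcol_i B i)^t* = \mxrow_i (B i)^t*.
Proof. by rewrite tr_mxcol; apply/matrixP => i j; rewrite !mxE. Qed.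

(** The slope is real, being the difference of the values at 1 and 0. Were it nonzero, the function
    would take the value -1 at [x = - ((a + 1) / r)]. *)
Lemma affine_ge0_slope0 (a r : C) :
  (forall x : C, x \is Num.real -> 0 <= a + x * r) -> r = 0.
Proof.
move=> h; have a0 : 0 <= a by have := h 0 (rpred0 _); rewrite mul0r addr0.
have r_real : r \is Num.real.
  have -> : r = (a + 1 * r) - a by rewrite mul1r addrC addKr.
  by apply: rpredB; rewrite realE ?h ?a0 // rpred1.
apply/eqP; apply: contraT => r0.
have xr : - ((a + 1) / r) \is Num.real.
  by rewrite rpredN rpredM ?rpredV // realE addr_ge0.
have := h _ xr; rewrite mulNr divfK // opprD addrA subrr sub0r.
by rewrite oppr_ge0 ler10.
Qed.

End Adjoint.

(** * Kernels and factorisations of positive semidefinite matrices *)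

Section PositiveSemidefinite.
Variable R : realType.
Local Notation C := R[i].

(* Perturbing u to v + x u with x real or imaginary makes the quadratic form
   affine in x; nonnegativity then forces its slope to vanish. *)
Lemma psdmx_ker (n : nat) (P : 'M[C]_n) (u : 'cV[C]_n) :
  psdmx P -> (u^t* *m P *m u) 0 0 = 0 -> P *m u = 0 /\ P^t* *m u = 0.
Proof.
move=> Ppsd Pu0.
pose f (x y : 'cV[C]_n) := (x^t* *m P *m y) 0 0.
have fDl x x' y : f (x + x') y = f x y + f x' y.
  by rewrite /f adjmxD !mulmxDl mxE.
have fDr x y y' : f x (y + y') = f x y + f x y'.
  by rewrite /f mulmxDr mxE.
have fZl z x y : f (z *: x) y = z^* * f x y.
  by rewrite /f adjmxZ -mulmxA -scalemxAl mulmxA mxE.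
have fZr z x y : f x (z *: y) = z * f x y.
  by rewrite /f -scalemxAr mxE.
have fE v z : f (v + z *: u) (v + z *: u) = f v v + (z * f v u + z^* * f u v).
  have fu0 : f u u = 0 by [].
  by rewrite fDl !fDr !fZl !fZr fu0 !mulr0 addr0 addrA.
have pq v : f v u = 0 /\ f u v = 0.
  have hs : f v u + f u v = 0.
    apply: (@affine_ge0_slope0 _ (f v v)) => x xr.
    by have := Ppsd (v + x *: u); rewrite -/(f _ _) fE (CrealP xr) -mulrDr.
  have hd : 'i%R * (f v u - f u v) = 0.
    apply: (@affine_ge0_slope0 _ (f v v)) => x xr.
    have := Ppsd (v + (x * 'i%R) *: u); rewrite -/(f _ _) fE.
    by rewrite rmorphM /= (CrealP xr) conjCi mulrN mulNr -mulrBr mulrA.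
  move/eqP: hd; rewrite mulf_eq0 (negPf (neq0Ci _)) /= subr_eq0 => /eqP hd.
  move/eqP: hs; rewrite hd -mulr2n mulrn_eq0 /= => /eqP ->.
  by split.
split; apply/matrixP => i j; rewrite ord1 [RHS]mxE.
- have [+ _] := pq (delta_mx i 0); rewrite /f -mulmxA.
  by rewrite trmx_delta map_delta_mx -rowE mxE.
- have [_ +] := pq (delta_mx i 0); rewrite /f -colE mxE => /(congr1 Num.conj).
  rewrite rmorph0 => <-; rewrite !mxE rmorph_sum; apply: eq_bigr => k _.
  by rewrite !mxE rmorphM /= conjCK mulrC.
Qed.

Lemma psdmx_isotropic_l (n : nat) (P Q : 'M[C]_n) (a b : C) (u : 'cV[C]_n) :
  psdmx P -> psdmx Q -> 0 < a -> 0 <= b ->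
  (u^t* *m (a *: P + b *: Q) *m u) 0 0 = 0 -> (u^t* *m P *m u) 0 0 = 0.
Proof.
move=> /(_ u) P0 /(_ u) Q0 a0 b0.
have -> : (u^t* *m (a *: P + b *: Q) *m u) 0 0 =
    a * (u^t* *m P *m u) 0 0 + b * (u^t* *m Q *m u) 0 0.
  have mulZ c (X : 'M[C]_n) :
      u^t* *m (c *: X) *m u = c *: (u^t* *m X *m u).
    by rewrite -scalemxAr -scalemxAl.
  by rewrite mulmxDr mulmxDl !mulZ mxE; congr (_ + _); rewrite mxE.
move: (fun_of_matrix _ 0 0) (fun_of_matrix _ 0 0) P0 Q0 => p q p0 q0.
move/eqP; rewrite paddr_eq0; [|exact: mulr_ge0 (ltW a0) p0|exact: mulr_ge0].
by rewrite mulf_eq0 (gt_eqF a0) => /andP[/eqP].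
Qed.

(** Both [P] and its adjoint vanish on the kernel of [W^t*], so both row spaces lie in that of
    [W^t*]. Its pseudo-inverse then factors [P] on the right and, after taking adjoints, on the
    left. *)
Lemma psdmx_range (n r : nat) (P : 'M[C]_n) (W : 'M[C]_(n, r)) :
  psdmx P ->
  (forall u : 'cV[C]_n, W^t* *m u = 0 -> (u^t* *m P *m u) 0 0 = 0) ->
  exists M : 'M[C]_r, P = W *m M *m W^t*.
Proof.
move=> Ppsd Pker.
have ker0 Q : (forall u : 'cV[C]_n, W^t* *m u = 0 -> Q *m u = 0) ->
    (Q <= W^t*)%MS.
  move=> h; rewrite submxE; have := mulmx_coker (W^t*).
  move: (cokermx _) => K WK; apply/eqP/matrixP => i j.
  have := h (col j K); rewrite colE !mulmxA WK.
  rewrite mul0mx => /(_ erefl); rewrite -colE => /matrixP /(_ i 0).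
  by rewrite !mxE.
have PW : (P <= W^t*)%MS.
  by apply: ker0 => u /Pker /(psdmx_ker Ppsd) [].
have P'W : (P^t* <= W^t*)%MS.
  by apply: ker0 => u /Pker /(psdmx_ker Ppsd) [].
have PE : P = W *m ((pinvmx (W^t*))^t* *m P).
  by have := congr1 (fun X => X^t*) (mulmxKpV P'W); rewrite !adjmxM !trmxCK.
exists ((pinvmx (W^t*))^t* *m P *m pinvmx (W^t*)).
by rewrite mulmxA -PE mulmxKpV.
Qed.

Lemma psdmx_mul_adj (n r : nat) (W : 'M[C]_(n, r)) : psdmx (W *m W^t*).
Proof.
move=> u; rewrite mulmxA -mulmxA.
have -> : u^t* *m W = (W^t* *m u)^t* by rewrite adjmxM trmxCK.
rewrite mxE sumr_ge0 // => i _; rewrite !mxE mulrC; exact: mul_conjC_ge0.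
Qed.
End PositiveSemidefinite.

(** * Choi matrices, Kraus forms and the extremality criteria *)

Section Choi.
Variables (R : realType) (d r : nat).
Local Notation C := R[i].
Implicit Types (Psi : 'End('M[C]_d)) (K : 'I_r -> 'M[C]_d).

Definition choi Psi : 'M[C]_(\sum_(i < d) d) :=
  \mxblock_(i < d, j < d) Psi (delta_mx i j).

(** The matrix has rank one: [W] is the vector [sum_i e_i (x) e_i]. Its image under the ampliation
    of [Psi] is [choi Psi]. *)
Lemma delta_block_psd :
  psdmx (\mxblock_(i < d, j < d) (delta_mx i j : 'M[C]_d)).
Proof.
pose W := \mxcol_(i < d) (delta_mx i 0 : 'cV[C]_d).
suff -> : \mxblock_(i < d, j < d) (delta_mx i j : 'M[C]_d) = W *m W^t*.
  exact: psdmx_mul_adj.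
rewrite /W adj_mxcol mul_mxcol_mxrow; apply: eq_mxblock => i j.
by rewrite trmx_delta map_delta_mx mul_delta_mx.
Qed.

Lemma choi_psd Psi : completely_positive Psi -> psdmx (choi Psi).
Proof.
move=> /(_ d _ delta_block_psd); rewrite /ampliation /choi.
by congr psdmx; apply: eq_mxblock => i j; rewrite mxblockK.
Qed.

(** Column [k] is the vectorisation of [K k], whose columns are placed one below the other. *)
Definition stack K : 'M[C]_(\sum_(i < d) d, r) :=
  \mxcol_(i < d) \matrix_(a < d, k < r) K k a i.

Lemma delta_sandwich (B D : 'M[C]_d) i j a b :
  (B *m delta_mx i j *m D) a b = B a i * D j b.
Proof.
rewrite -(mul_delta_mx (0 : 'I_1)) mulmxA -colE -mulmxA -rowE.
by rewrite mxE big_ord1 !mxE.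
Qed.

(** Block [(i, j)] of the product is the right-hand sum at [rho = delta_mx i j], and matrix units
    determine a linear map. *)
Lemma choi_stackE Psi K (M : 'M[C]_r) :
  choi Psi = stack K *m M *m (stack K)^t* <->
  forall rho, Psi rho =
    \sum_k \sum_l M k l *: (K k *m rho *m (K l)^t*).
Proof.
pose T rho := \sum_k \sum_l M k l *: (K k *m rho *m (K l)^t*).
have TE i j : (\matrix_(a < d, k < r) K k a i) *m M *m
    (\matrix_(a < d, k < r) K k a j)^t* = T (delta_mx i j).
  apply/matrixP => a b; rewrite mxE summxE.
  under [RHS]eq_bigr do rewrite summxE.
  rewrite [RHS]exchange_big /=; apply: eq_bigr => l _.
  rewrite !mxE mulr_suml; apply: eq_bigr => k _.
  by rewrite [RHS]mxE delta_sandwich !mxE mulrA [K _ _ _ * M _ _]mulrC.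
have stackE : stack K *m M *m (stack K)^t* =
    \mxblock_(i < d, j < d) T (delta_mx i j).
  rewrite /stack adj_mxcol mxcol_mul mul_mxcol_mxrow.
  by apply: eq_mxblock => i j; rewrite TE.
rewrite stackE /choi; split=> [/eq_mxblockP PsiT rho | PsiT]; last first.
  by apply: eq_mxblock => i j; rewrite PsiT.
rewrite -/(T rho) [rho]matrix_sum_delta linear_sum /=.
have -> : T (\sum_i \sum_j rho i j *: delta_mx i j) =
    \sum_i \sum_j rho i j *: T (delta_mx i j).
  rewrite /T; under [RHS]eq_bigr do under eq_bigr do rewrite scaler_sumr.
  under [RHS]eq_bigr do rewrite exchange_big.
  rewrite [RHS]exchange_big; apply: eq_bigr => k _ /=.
  under [RHS]eq_bigr do under eq_bigr do rewrite scaler_sumr.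
  under [RHS]eq_bigr do rewrite exchange_big.
  rewrite [RHS]exchange_big; apply: eq_bigr => l _ /=.
  rewrite mulmx_sumr mulmx_suml scaler_sumr; apply: eq_bigr => i _.
  rewrite mulmx_sumr mulmx_suml scaler_sumr; apply: eq_bigr => j _.
  by rewrite -scalemxAr -scalemxAl !scalerA mulrC.
apply: eq_bigr => i _; rewrite linear_sum; apply: eq_bigr => j _.
by rewrite linearZ /= PsiT.
Qed.

Lemma kraus_diag K rho :
  \sum_k \sum_l (1%:M : 'M[C]_r) k l *: (K k *m rho *m (K l)^t*) =
  \sum_k K k *m rho *m (K k)^t*.
Proof.
apply: eq_bigr => k _; rewrite (bigD1 k) //= big1 => [|l lk].
  by rewrite mxE eqxx scale1r addr0.
by rewrite mxE eq_sym (negPf lk) scale0r.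
Qed.

(** The quadratic form of [ampliation Psi X] at [u] is the sum of those of [X] at the vectors [w k],
    obtained by applying the adjoint of [K k] to every block of [u]. *)
Lemma kraus_cp Psi K :
  (forall rho, Psi rho = \sum_k K k *m rho *m (K k)^t*) ->
  completely_positive Psi.
Proof.
move=> PsiK n X Xpsd u.
pose w k := \mxcol_(i < n) ((K k)^t* *m submxcol u i).
suff -> : u^t* *m ampliation Psi X *m u =
    \sum_k ((w k)^t* *m X *m w k).
  by rewrite summxE; apply: sumr_ge0 => k _; apply: Xpsd.
have quadE (v : 'I_n -> 'cV[C]_d) (Y : 'I_n -> 'I_n -> 'M[C]_d) :
    (\mxcol_i v i)^t* *m \mxblock_(i, j) Y i j *m \mxcol_i v i =
    \sum_j \sum_i ((v i)^t* *m Y i j *m v j).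
  rewrite adj_mxcol mul_mxrow_mxblock mul_mxrow_mxcol.
  by apply: eq_bigr => j _; rewrite mulmx_suml.
rewrite -[u in LHS]submxcolK quadE.
have wE k : (w k)^t* *m X *m w k = \sum_j \sum_i
    (((K k)^t* *m submxcol u i)^t* *m submxblock X i j *m
     ((K k)^t* *m submxcol u j)).
  by rewrite -[X in LHS]submxblockK quadE.
under [RHS]eq_bigr do rewrite wE.
rewrite [RHS]exchange_big; apply: eq_bigr => j _ /=.
rewrite [RHS]exchange_big; apply: eq_bigr => i _ /=.
rewrite PsiK mulmx_sumr mulmx_suml; apply: eq_bigr => k _.
by rewrite adjmxM trmxCK !mulmxA.
Qed.

(* The Choi matrix of Y vanishes on the kernel of that of Psi, which is the
   orthogonal complement of the stacked Kraus operators of Psi. *)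
Lemma kraus_dominated Psi Y Z K (l : R) :
  (forall rho, Psi rho = \sum_k K k *m rho *m (K k)^t*) ->
  completely_positive Y -> completely_positive Z -> 0 < l < 1 ->
  Psi = l%:C *: Y + (1 - l)%:C *: Z ->
  exists M : 'M[C]_r, forall rho,
    Y rho = \sum_k \sum_j M k j *: (K k *m rho *m (K j)^t*).
Proof.
move=> PsiK Ycp Zcp /andP[l0 l1] PsiYZ.
have choiPsi : choi Psi = stack K *m (stack K)^t*.
  rewrite -[X in X *m _]mulmx1; apply/choi_stackE => rho.
  by rewrite kraus_diag.
have choiYZ : choi Psi = l%:C *: choi Y + (1 - l)%:C *: choi Z.
  apply/matrixP => a b; rewrite !mxE PsiYZ lfunE /=.
  by rewrite !mxE !lfunE /= !mxE.
have [] := @psdmx_range R _ _ (choi Y) (stack K) (choi_psd Ycp).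
  move=> u Wu.
  apply: (psdmx_isotropic_l (choi_psd Ycp) (choi_psd Zcp)
    (a := l%:C) (b := (1 - l)%:C)).
  - by rewrite ltcR.
  - by rewrite lecR subr_ge0 ltW.
  - by rewrite -choiYZ choiPsi -!mulmxA Wu !mulmx0 mxE.
by move=> M /choi_stackE YM; exists M.
Qed.

Lemma mxtrace_mul_eq (B D : 'M[C]_d) :
  (forall rho, \tr (B *m rho) = \tr (D *m rho)) -> B = D.
Proof.
move=> h; apply/matrixP => i j; have := h (delta_mx j i).
have trE (X : 'M[C]_d) : \tr (X *m delta_mx j i) = X i j.
  rewrite -(mul_delta_mx (0 : 'I_1)) mulmxA -colE mxtrace_mulC -rowE.
  by rewrite /mxtrace big_ord1 !mxE.
by rewrite !trE.
Qed.

(** Shared end of both extremality arguments: [F k l] is [(K l)^t* *m K k] for trace preservation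
    and [K k *m (K l)^t*] for unitality. The entries of [M - 1] are the coefficients of a vanishing
    combination. *)
Lemma kraus_weights_eq1 (F : 'I_r -> 'I_r -> 'M[C]_d) (M : 'M[C]_r) :
  (forall x : 'M[C]_r, \sum_k \sum_l x k l *: F k l = 0 -> x = 0) ->
  \sum_k \sum_l M k l *: F k l = \sum_k F k k -> M = 1%:M.
Proof.
move=> Ffree MF; apply/eqP; rewrite -subr_eq0; apply/eqP/Ffree.
under eq_bigr do under eq_bigr do rewrite mxE mxE scalerBl.
under eq_bigr do rewrite sumrB.
rewrite sumrB MF -sumrB big1 // => k _; apply/eqP; rewrite subr_eq0.
apply/eqP; rewrite (bigD1 k) //= big1 => [|l lk].
  by rewrite mxE eqxx scale1r addr0.
by rewrite mxE eq_sym (negPf lk) scale0r.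
Qed.

(** Here [S] stands for CPT or UCP. A component of a decomposition of [Psi] is a weighted Kraus sum
    over [K]; weights forced to be the identity make it [Psi] itself. *)
Lemma extreme_point_kraus (S : 'End('M[C]_d) -> Prop) Psi K :
  (forall rho, Psi rho = \sum_k K k *m rho *m (K k)^t*) ->
  (forall Y, S Y -> completely_positive Y) ->
  (forall Y (M : 'M[C]_r), S Y ->
     (forall rho, Y rho =
        \sum_k \sum_l M k l *: (K k *m rho *m (K l)^t*)) -> M = 1%:M) ->
  S Psi -> extreme_point S Psi.
Proof.
move=> PsiK Scp SM SPsi; split=> // Y Z l SY SZ l01 PsiYZ.
have eqPsi (T : 'End('M[C]_d)) (M : 'M[C]_r) : S T ->
    (forall rho, T rho =
       \sum_k \sum_l M k l *: (K k *m rho *m (K l)^t*)) -> T = Psi.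
  move=> ST TM; apply/lfunP => rho.
  by rewrite TM (SM _ _ ST TM) kraus_diag PsiK.
split.
  have [M YM] := kraus_dominated PsiK (Scp _ SY) (Scp _ SZ) l01 PsiYZ.
  exact: eqPsi YM.
(* Exchanging [Y] with [Z] and [l] with [1 - l] reduces the second component to the first. *)
have l01' : 0 < 1 - l < 1.
  by case/andP: l01 => l0 l1; rewrite subr_gt0 l1 ltrBlDr ltrDl.
have PsiZY : Psi = (1 - l)%:C *: Z + (1 - (1 - l))%:C *: Y.
  by rewrite opprB addrCA subrr addr0 addrC.
have [M ZM] := kraus_dominated PsiK (Scp _ SZ) (Scp _ SY) l01' PsiZY.
exact: eqPsi ZM.
Qed.

(** Moving the adjoint of [K l] to the front of the trace turns trace preservation, for all [rho],
    into a matrix identity between combinations of the products in the last hypothesis. *)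
Lemma extreme_CPT Psi K :
  (forall rho, Psi rho = \sum_k K k *m rho *m (K k)^t*) ->
  \sum_k (K k)^t* *m K k = 1%:M ->
  (forall x : 'M[C]_r,
     \sum_k \sum_l x k l *: ((K l)^t* *m K k) = 0 -> x = 0) ->
  extreme_point (@CPT R d) Psi.
Proof.
move=> PsiK K1 Kfree; apply: (extreme_point_kraus PsiK) => [Y []//|Y M|].
  move=> [_ Ytp] YM.
  apply: (kraus_weights_eq1 (F := fun k l => (K l)^t* *m K k)) => //.
  rewrite K1; apply: mxtrace_mul_eq => rho; rewrite mul1mx -(Ytp rho) YM.
  rewrite mulmx_suml !linear_sum; apply: eq_bigr => k _ /=.
  rewrite mulmx_suml !linear_sum; apply: eq_bigr => l _ /=.
  by rewrite -scalemxAl !mxtraceZ [in RHS]mxtrace_mulC mulmxA.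
split; first exact: kraus_cp PsiK.
move=> X; rewrite PsiK -[X in RHS]mul1mx -K1 mulmx_suml !linear_sum.
by apply: eq_bigr => k _ /=; rewrite mxtrace_mulC mulmxA.
Qed.

Lemma extreme_UCP Psi K :
  (forall rho, Psi rho = \sum_k K k *m rho *m (K k)^t*) ->
  \sum_k K k *m (K k)^t* = 1%:M ->
  (forall x : 'M[C]_r,
     \sum_k \sum_l x k l *: (K k *m (K l)^t*) = 0 -> x = 0) ->
  extreme_point (@UCP R d) Psi.
Proof.
move=> PsiK K1 Kfree; apply: (extreme_point_kraus PsiK) => [Y []//|Y M|].
  move=> [_ Y1] YM.
  apply: (kraus_weights_eq1 (F := fun k l => K k *m (K l)^t*)) => //.
  rewrite K1 -[RHS]Y1 YM; apply: eq_bigr => k _; apply: eq_bigr => l _.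
  by rewrite mulmx1.
split; first exact: kraus_cp PsiK.
by rewrite /unital PsiK -[RHS]K1; apply: eq_bigr => k _; rewrite mulmx1.
Qed.

End Choi.

Lemma free_image (K : fieldType) (vT : vectType K) (I : finType) (f : I -> vT) :
  (forall x : I -> K, \sum_i x i *: f i = 0 -> forall i, x i = 0) ->
  free [seq f i | i : I].
Proof.
move=> ffree; suff: free (codom_tuple f) by [].
apply/freeP => x xf i.
have := ffree (x \o enum_rank) _ (enum_val i); rewrite /= enum_valK; apply.
rewrite -[RHS]xf (reindex_onto enum_val enum_rank) => [|k _]; last first.
  exact: enum_rankK.
apply: eq_big => [k|k _]; first by rewrite enum_valK eqxx.
by rewrite enum_valK nth_image.
Qed.

(** * Products of the modified reflections: support, weights and freeness *)

Section Reflections.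
Variables (R : realType) (nu : nat) (t : R).
Local Notation C := R[i].
Local Notation d := nu.*2.+1.
Implicit Types (i j m n c : 'I_d).

Lemma ord_mulrn_card c : c *+ d = 0.
Proof. by apply/val_inj; rewrite Zp_mulrn /= modnMl. Qed.

(** Since [2 (nu + 1) = d + 1], the number [nu + 1] inverts 2 modulo [d]; this is where [d] being
    odd enters. *)
Lemma ord_half c : c *+ 2 *+ nu.+1 = c.
Proof. by rewrite -mulrnA mul2n doubleS mulrS ord_mulrn_card addr0. Qed.

Lemma ord_double_inj : injective (fun c => c + c).
Proof.
by move=> m n /= mn; rewrite -(ord_half m) -(ord_half n) !mulr2n mn.
Qed.

Lemma ord_double_eq m n : (m + m == n + n) = (m == n).
Proof. exact: (inj_eq ord_double_inj). Qed.

(** With [j = m + k] the full reflection is a sum over [k] mod [d]: [k = 0] is the subtracted term,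
    and the ranges up to [nu] and beyond it give the two families in [V]. *)
Lemma V_antidiagonal m :
  V R m = \sum_(j < d) delta_mx j (m + m - j) - delta_mx m m.
Proof.
rewrite (reindex_inj (addrI m)) /=.
pose g k : 'M[C]_d := delta_mx (m + inZp k) (m - inZp k).
have -> : \sum_(j < d) delta_mx (m + j) (m + m - (m + j)) =
    \sum_(0 <= k < d) g k.
  rewrite big_mkord; apply: eq_bigr => j _.
  by rewrite /g valZpK opprD addrA addrK.
have inZp0 : inZp 0 = 0 :> 'I_d by apply/val_inj; rewrite /= mod0n.
rewrite big_ltn // [g 0%N]/g inZp0 addr0 subr0 [X in X - _]addrC addrK.
rewrite (@big_cat_nat _ _ _ nu.+1) //=; last by rewrite ltnS -addnn leq_addr.
rewrite /V big_split; congr (_ + _).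
(* Reversing the upper range replaces [k] by [d - k = - k], which swaps the two indices of the
   matrix unit. *)
apply: esym; rewrite big_nat_rev (big_addn 1 d nu).
have -> : (d - nu = nu.+1)%N by rewrite -addnn -addnS addKn.
apply: eq_big_nat => k /andP[k0 kd].
have -> : (1 + nu + d - (k + nu).+1 = d - k)%N by lia.
rewrite /g; have -> : inZp (d - k) = - inZp k :> 'I_d.
  apply/val_inj; rewrite /= [(k %% d)%N]modn_small //.
  by rewrite (leq_trans kd) // ltnS -addnn leq_addr.
by rewrite opprK.
Qed.

Lemma A_entry m i j :
  A t m i j = (i + j == m + m)%:R * (if i == m then t%:C else 1).
Proof.
rewrite /A V_antidiagonal !mxE summxE.
have -> : \sum_k (delta_mx k (m + m - k) : 'M[C]_d) i j =
    (i + j == m + m)%:R.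
  rewrite (bigD1 i) //= big1 => [|k ki]; last first.
    by rewrite mxE eq_sym (negPf ki).
  by rewrite addr0 mxE eqxx /= eq_sym subr_eq addrC eq_sym [j + i]addrC.
have [->|im] := eqVneq i m; last by rewrite /= mulr0 subr0 addr0 mulr1.
rewrite (inj_eq (addrI m)); case: eqP => _ /=.
  by rewrite subrr add0r mulr1 mul1r.
by rewrite mulr0 subrr addr0 mul0r.
Qed.

Lemma A_adj m : (A t m)^t* = A t m.
Proof.
apply/matrixP => i j; rewrite mxE mxE !A_entry rmorphM rmorph_nat [j + i]addrC.
have [ijm|_] := eqVneq (i + j) (m + m); last by rewrite !mul0r.
have -> : (j == m) = (i == m).
  apply/eqP/eqP => e; move: ijm; rewrite e; first exact: addIr.
  exact: addrI.
by rewrite !mul1r; case: ifP => _; rewrite ?rmorph1 //; exact: conjc_real.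
Qed.

(** The entry of [A t m] in row [i] at column [m + m - i], outside which that row vanishes; by
    symmetry rows and columns may be exchanged. *)
Definition weight i m : C := if i == m then t%:C else 1.

Lemma A_mul_entry m n i j :
  (A t m *m A t n) i j =
    (m + m - i + j == n + n)%:R * (weight i m * weight j n).
Proof.
rewrite mxE (bigD1 (m + m - i)) //= big1 => [|k ki]; last first.
  have -> : A t m i k = 0; last by rewrite mul0r.
  have ikm : (i + k == m + m) = (k == m + m - i).
    by rewrite [RHS]eq_sym subr_eq [RHS]eq_sym [k + i]addrC.
  by rewrite A_entry ikm (negPf ki) mul0r.
rewrite addr0 !A_entry [i + _]addrC subrK eqxx mul1r.
have [ijn|_] := eqVneq (m + m - i + j) (n + n); last first.
  by rewrite !mul0r mulr0.
(* On the support the inner index and [j] add up to [n + n], so one equals [n] exactly when the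
   other does. *)
have -> : (m + m - i == n) = (j == n).
  by apply/eqP/eqP => e; move: ijn; rewrite e; [exact: addrI|exact: addIr].
by rewrite !mul1r.
Qed.

(** Off-diagonal entries vanish because reflections are involutions. At a diagonal position [j], the
    term [m = j] gives [t ^+ 2] and each of the others gives 1. *)
Lemma sum_A_square :
  \sum_(m < d) A t m *m A t m = (d%:R - 1 + t ^+ 2)%:C%:M.
Proof.
apply/matrixP => i j; rewrite summxE.
have diag m : (m + m - i + j == m + m) = (j == i).
  by rewrite -addrA -[X in _ == X]addr0 (inj_eq (addrI _)) addrC subr_eq0.
under eq_bigr do rewrite A_mul_entry diag.
rewrite mxE eq_sym; have [->|_] := eqVneq; last first.
  by rewrite big1 // => m _; rewrite mul0r.
rewrite (bigD1 j) //= /weight eqxx (eq_bigr (fun=> 1)) => [|m mi]; last first.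
  by rewrite eq_sym (negPf mi) !mul1r.
rewrite sumr_const cardC1 card_ord /= !mul1r mulr1n.
by rewrite -natr1 addrK rmorphD rmorphXn rmorph_nat addrC.
Qed.

(** This is the invertibility of [J - a 1] for [a] other than 0 and [d]: summing over [j] gives
    [a S = d S] for the total [S], hence [S = 0]. *)
Lemma scale_sum_eq0 (a : C) (y : 'I_d -> C) :
  a != d%:R -> (forall j, a * y j = \sum_n y n) -> a != 0 ->
  forall j, y j = 0.
Proof.
move=> ad ay a0 j; set S := \sum_n y n in ay.
have : a * S = d%:R * S.
  rewrite mulr_sumr (eq_bigr _ (fun k _ => ay k)).
  by rewrite sumr_const card_ord mulr_natl.
move/eqP; rewrite -subr_eq0 -mulrBl mulf_eq0 subr_eq0 (negPf ad) /= => /eqP S0.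
by move/eqP: (ay j); rewrite S0 mulf_eq0 (negPf a0) => /eqP.
Qed.

(** At the entry [(j + 2c, j)] the product indexed by [(m, n)] survives only if [2 (m - c) = 2 n],
    that is [m = c + n] by injectivity of doubling. *)
Lemma diagonal_system (x : 'I_d -> 'I_d -> C) :
  \sum_(m < d) \sum_(n < d) x m n *: (A t m *m A t n) = 0 ->
  forall c j, \sum_n x (c + n) n * (weight (j + c) n * weight j n) = 0.
Proof.
move=> x0 c j.
have := congr1 (fun X : 'M_d => X (j + (c + c)) j) x0; rewrite summxE mxE.
under eq_bigr do rewrite summxE.
rewrite exchange_big /= => yw; rewrite -[RHS]yw; apply: eq_bigr => n _.
have row m : m + m - (j + (c + c)) + j = (m - c) + (m - c).
  by rewrite -addrA [- _ + j]addrC opprD [j + _]addrA subrr add0r opprD addrACA.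
rewrite (bigD1 (c + n)) //= big1 => [|m mn]; last first.
  rewrite mxE A_mul_entry row ord_double_eq subr_eq [n + c]addrC.
  by rewrite (negPf mn) mul0r mulr0.
rewrite mxE A_mul_entry row ord_double_eq [c + n]addrC addrK eqxx mul1r addr0.
by rewrite /weight addrCA [n + c]addrC (inj_eq (addrI c)).
Qed.

(** Each weight is 1 minus [s] times an indicator. In the expanded product the two indicators, at
    [j + c] and at [j], overlap only when [c = 0]. *)
Lemma weighted_sum (y : 'I_d -> C) (c j : 'I_d) (s := (1 - t)%:C) :
  \sum_n y n * (weight (j + c) n * weight j n) =
  \sum_n y n - s * (y (j + c) + y j) + s ^+ 2 * (c == 0)%:R * y j.
Proof.
have sum_delta a : \sum_n y n * (a == n)%:R = y a.
  rewrite (bigD1 a) //= eqxx mulr1 big1 ?addr0 // => n na.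
  by rewrite eq_sym (negPf na) mulr0.
have weightE a n : weight a n = 1 - s * (a == n)%:R.
  rewrite /weight /s; case: eqP => _; last by rewrite mulr0 subr0.
  by rewrite mulr1 rmorphB rmorph1 opprB addrC subrK.
have delta2 n : (j + c == n)%:R * (j == n)%:R = (c == 0)%:R * (j == n)%:R :> C.
  case: (j =P n) => [<-|_]; last by rewrite !mulr0.
  by rewrite -[X in _ == X]addr0 (inj_eq (addrI j)).
rewrite -!sum_delta mulrDr !mulr_sumr -big_split /= -sumrB -big_split /=.
apply: eq_bigr => n _; rewrite !weightE.
have -> : s ^+ 2 * (c == 0)%:R * (y n * (j == n)%:R) =
    s ^+ 2 * y n * ((j + c == n)%:R * (j == n)%:R) by rewrite delta2; ring.
ring.
Qed.

Lemma A_mul_free (x : 'I_d -> 'I_d -> C) :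
  (0 < nu)%N -> -1 < t < 1 -> 2 * (1 - t) != d%:R ->
  \sum_(m < d) \sum_(n < d) x m n *: (A t m *m A t n) = 0 ->
  forall m n, x m n = 0.
Proof.
move=> nu_gt0 ht hd /diagonal_system x0 m n; rewrite -[m](subrK n).
have := x0 (m - n); set c := m - n; clearbody c => {}x0.
pose y k := x (c + k) k; rewrite -/(y n).
set S := \sum_k y k; set s := (1 - t)%:C.
have {x0} y0 j : S - s * (y (j + c) + y j) + s ^+ 2 * (c == 0)%:R * y j = 0.
  by rewrite -weighted_sum x0.
have [t1 t1'] := andP ht.
have neqC (a b : R) : a != b -> a%:C != b%:C.
  by move=> ab; rewrite (inj_eq (@complexI R)).
have dC : d%:R = (d%:R)%:C :> C by rewrite rmorph_nat.
(* For [c = 0] the system reads [(2 s - s^2) y j = S], and [2 s - s^2 = 1 - t^2] lies in [(0, 1]],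
   so it is neither 0 nor [d]. *)
have [c0|c0] := eqVneq c 0.
  have t2 : t ^+ 2 < 1 by nra.
  apply: (@scale_sum_eq0 (1 - t ^+ 2)%:C).
  - rewrite dC; apply: neqC; rewrite lt_eqF // -natr1.
    have : 1 <= (nu.*2)%:R :> R by rewrite ler1n double_gt0.
    by nra.
  - move=> j; have := y0 j; rewrite c0 eqxx addr0 mulr1 => y0j.
    have -> : (1 - t ^+ 2)%:C = 2 * s - s ^+ 2.
      by rewrite /s !rmorphB rmorphXn !rmorph1; ring.
    rewrite -/S -[RHS]subr0 -y0j; ring.
  - by apply: neqC; rewrite subr_eq0 eq_sym lt_eqF.
have {}y0 j : s * (y (j + c) + y j) = S.
  by apply/eqP; rewrite eq_sym -subr_eq0 -(y0 j) (negPf c0) mulr0 mul0r addr0.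
have s0 : s != 0 by apply: neqC; rewrite subr_eq0 eq_sym lt_eqF.
(* y (j + c) + y j does not depend on j, so y has period 2 c, hence period c
   because 2 is invertible mod d. *)
have period2 j : y (j + c *+ 2) = y j.
  have := y0 (j + c); rewrite -(y0 j) => /(mulfI s0).
  by rewrite mulr2n addrA [RHS]addrC => /addIr.
have period j : y (j + c) = y j.
  rewrite -{1}[c]ord_half.
  by elim: nu.+1 => [|k IHk]; rewrite ?addr0 // mulrSr addrA period2.
(* Periodicity reduces the system to [2 s y j = S]. *)
apply: (@scale_sum_eq0 (2 * s)).
- rewrite dC (_ : 2 * s = (2 * (1 - t))%:C); first exact: neqC.
  by rewrite rmorphM rmorph_nat.
- by move=> j; rewrite -[RHS](y0 j) period; ring.
- by rewrite mulf_neq0 // pnatr_eq0.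
Qed.
End Reflections.

(** * Normalised Kraus operators and the extremality of the channel *)

Theorem theorem3p14 (R : realType) (nu : nat) (t : R)
    (hd : (3 <= nu.*2.+1)%N) (ht : -1 < t < 1) :
  (forall m : 'I_(nu.*2.+1),
     V R m = \sum_(j < nu.*2.+1) delta_mx j (m + m - j) - delta_mx m m) /\
  (forall m : 'I_(nu.*2.+1), A t m = (A t m) ^t*) /\
  ((3 < nu.*2.+1)%N \/ (nu.*2.+1 = 3%N /\ t <> - 2^-1) ->
     free [seq (A t p.1) ^t* *m A t p.2
             | p : 'I_(nu.*2.+1) * 'I_(nu.*2.+1)] /\
     extreme_point (@CPT R (nu.*2.+1)) (Phi nu t) /\
     extreme_point (@UCP R (nu.*2.+1)) (Phi nu t)).
Proof.
have nu_gt0 : (0 < nu)%N by case: nu hd.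
split; first exact: V_antidiagonal.
split=> [m|cases]; first by rewrite A_adj.
have [t1 t1'] := andP ht.
(* Since [2 (1 - t) < 4], equality can occur only for [d = 3], where it means [t = -1/2]. *)
have hd' : 2 * (1 - t) != (nu.*2.+1)%:R.
  case: cases => [d3|[-> tneq]].
    have d4 : 4 <= (nu.*2.+1)%:R :> R by rewrite (ler_nat _ 4).
    by rewrite lt_eqF //; apply: lt_le_trans d4; lra.
  by apply/eqP => e; apply: tneq; lra.
have Afree x := A_mul_free (x := x) nu_gt0 ht hd'.
pose c : R := (nu.*2.+1)%:R - 1 + t ^+ 2.
have c0 : 0 < c.
  by rewrite /c -natr1 addrK ltr_wpDr ?sqr_ge0 // ltr0n double_gt0.
(* Each of the two Kraus factors takes a square root of the normalisation [c^-1]; as [a] is real,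
   they stay self-adjoint. *)
pose a : R := Num.sqrt c^-1.
have aa : a%:C * a%:C = (c^-1)%:C.
  by rewrite -rmorphM -expr2 sqr_sqrtr // invr_ge0 ltW.
have a0 : a%:C * a%:C != 0 :> R[i].
  by rewrite aa (inj_eq (@complexI R) _ 0) invr_eq0 gt_eqF.
pose K (m : 'I_(nu.*2.+1)) : 'M[R[i]]_(nu.*2.+1) := a%:C *: A t m.
have K_adj m : (K m)^t* = K m.
  by rewrite adjmxZ A_adj; congr (_ *: _); apply: conjc_real.
have KMK m n : K m *m K n = (c^-1)%:C *: (A t m *m A t n).
  by rewrite -scalemxAl -scalemxAr scalerA aa.
have Kfree (x : 'I_(nu.*2.+1) -> 'I_(nu.*2.+1) -> R[i]) :
    \sum_m \sum_n x m n *: (K m *m K n) = 0 -> forall m n, x m n = 0.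
  move=> Kx; apply: Afree; apply: (scalerI a0); rewrite scaler0 -[RHS]Kx.
  rewrite scaler_sumr; apply: eq_bigr => m _.
  rewrite scaler_sumr; apply: eq_bigr => n _.
  by rewrite KMK aa !scalerA mulrC.
have K1 : \sum_m K m *m K m = 1%:M.
  under eq_bigr do rewrite KMK.
  rewrite -scaler_sumr sum_A_square scale_scalar_mx -rmorphM.
  by rewrite mulVf ?rmorph1 // gt_eqF.
have PhiK rho : Phi nu t rho = \sum_k K k *m rho *m (K k)^t*.
  rewrite PhiE /conjugation_sum -/c scaler_sumr; apply: eq_bigr => k _.
  by rewrite K_adj -!scalemxAl -scalemxAr scalerA aa.
split.
  apply: free_image => x xA [m n].
  apply: (Afree (fun m n => x (m, n))); rewrite pair_bigA -[RHS]xA /=.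
  by apply: eq_bigr => -[k l] _; rewrite A_adj.
split.
  apply: extreme_CPT PhiK _ _.
    by under eq_bigr do rewrite K_adj.
  move=> x xK; apply/matrixP => k l; rewrite mxE.
  (* The trace-preserving criterion pairs [x k l] with [K l *m K k], hence the transposed
     coefficients. *)
  apply: (Kfree (fun m n => x n m)); rewrite exchange_big -[RHS]xK /=.
  by apply: eq_bigr => i _; apply: eq_bigr => j _; rewrite K_adj.
apply: extreme_UCP PhiK _ _.
  by under eq_bigr do rewrite K_adj.
move=> x xK; apply/matrixP => k l; rewrite mxE.
apply: Kfree; rewrite -[RHS]xK /=.
by apply: eq_bigr => i _; apply: eq_bigr => j _; rewrite K_adj.
Qed.
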